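(* Let $\alpha,\beta,\gamma,\delta\in\mathbb{R}$ (not necessarily distinct), and let $i,j\ge 0$ be integers. Each of the following sets is subsoluble and therefore Ramsey: - the set of all permutations of the coordinates of $(\underbrace{\alpha,\ldots,\alpha}_{i},\underbrace{\beta,\ldots,\beta}_{j})$ in $\mathbb{R}^{i+j}$; - the set of all permutations of the coordinates of $(\underbrace{\alpha,\ldots,\alpha}_{i},\underbrace{\beta,\ldots,\beta}_{j},\gamma)$ in $\mathbb{R}^{i+j+1}$; - the set of all permutations of the coordinates of $(\underbrace{\alpha,\ldots,\alpha}_{i},\underbrace{\beta,\ldots,\beta}_{j},\gamma,\gamma)$ in $\mathbb{R}^{i+j+2}$; - the set of all permutations of the coordinates of $(\underbrace{\alpha,\ldots,\alpha}_{i},\underbrace{\beta,\ldots,\beta}_{j},\gamma,\delta)$ in $\mathbb{R}^{i+j+2}$.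
   Context: A finite set $X\subset\mathbb{R}^d$ is called Ramsey if for every positive integer $k$ there exists an integer $n$ such that whenever $\mathbb{R}^n$ is coloured with $k$ colours, there is a monochromatic isometric copy of $X$ in $\mathbb{R}^n$. Group actions on a finite set $X\subset\mathbb{R}^d$ are by isometries, i.e. every group element acts as a distance-preserving bijection of $X$. A finite set $X\subset\mathbb{R}^d$ is called soluble if there is a soluble (solvable) group that acts transitively on $X$. A finite set $X\subset\mathbb{R}^d$ is called subsoluble if there is a soluble set $Y\subset\mathbb{R}^{n}$, for some $n$ (possibly larger than $d$), containing an isometric copy of $X$. Known theorem of Kříž, which may be used: if $X\subset\mathbb{R}^d$ is a finite set on which some soluble group acts transitively (by isometries), then $X$ is Ramsey. *)

(* Defs.v *)
From mathcomp Require Import all_boot all_order all_algebra all_fingroup all_solvable.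
From mathcomp Require Import finmap reals.

Set Implicit Arguments.
Unset Strict Implicit.
Unset Printing Implicit Defensive.

Import Order.TTheory GRing.Theory Num.Theory.
Local Open Scope fset_scope.
Local Open Scope ring_scope.

(* The Euclidean distance; the norm that MathComp-Analysis puts on 'rV[R]_n
   is the sup norm, hence not suitable here. *)
Definition edist (R : realType) (n : nat) (x y : 'rV[R]_n) : R :=
  Num.sqrt (\sum_(k < n) (x ord0 k - y ord0 k) ^+ 2).

(* Z is an isometric copy of X; only the values of f on X matter. *)
Definition isometric_copy (R : realType) (d n : nat)
    (X : {fset 'rV[R]_d}) (Z : {fset 'rV[R]_n}) : Prop :=
  exists2 f : 'rV[R]_d -> 'rV[R]_n,
    {in X &, forall x y, edist (f x) (f y) = edist x y}
    & Z = [fset f x | x in X].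

Definition ramsey (R : realType) (d : nat) (X : {fset 'rV[R]_d}) : Prop :=
  forall k : nat, (0 < k)%N ->
  exists n : nat, forall colour : 'rV[R]_n -> 'I_k,
  exists2 Z : {fset 'rV[R]_n}, isometric_copy X Z
    & exists c : 'I_k, {in Z, forall z, colour z = c}.

(* Groups are finite here: a group acting on a finite set acts through a
   finite quotient, and quotients of soluble groups are soluble. *)
Definition soluble (R : realType) (d : nat) (X : {fset 'rV[R]_d}) : Prop :=
  exists (gT : finGroupType) (G : {group gT}) (to : action G X),
  [/\ solvable G,
      [transitive G, on [set: X] | to]
    & {in G, forall g, forall x y : X,
         edist (val (to x g)) (val (to y g)) = edist (val x) (val y)}].

Definition subsoluble (R : realType) (d : nat) (X : {fset 'rV[R]_d}) : Prop :=
  exists (n : nat) (Y : {fset 'rV[R]_n}), soluble Y /\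
  exists2 Z : {fset 'rV[R]_n}, isometric_copy X Z & Z `<=` Y.

(* Kriz's theorem (Permutation groups in Euclidean Ramsey theory, 1991). *)
Definition kriz_theorem (R : realType) : Prop :=
  forall (d : nat) (X : {fset 'rV[R]_d}), soluble X -> ramsey X.

(* All the vectors obtained by permuting the coordinates of (s_0, ..., s_(n-1));
   meant for size s = n. *)
Definition coord_perms (R : realType) (n : nat) (s : seq R) :
    {fset 'rV[R]_n} :=
  [fset col_perm p (\row_(k < n) s`_k) | p : 'S_n].

(* Main.v *)
Require Import Defs.
From mathcomp Require Import all_boot all_order all_algebra all_fingroup all_solvable.
From mathcomp Require Import finmap reals.
From mathcomp Require Import ring zify.

(** Centre the picture at the midpoint of [alpha] and [beta], so that these two
values become [h] and [-h], and pad all vectors with [alpha] up to a prime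
number [p] of coordinates.  Every vector of the set then has entries [h] or
[-h] outside two positions.  Hence it lies in the orbit of a single vector under
the signed permutations of the coordinates whose underlying permutation is an
affine map of the field with [p] elements.  This group is soluble, with derived
length at most three, and it moves the two exceptional positions to any two
others because affine maps are 2-transitive. *)

Set Implicit Arguments.
Unset Strict Implicit.
Unset Printing Implicit Defensive.

Import Order.TTheory GRing.Theory Num.Theory.
Local Open Scope fset_scope.
Local Open Scope ring_scope.

(** * Orbits of soluble groups, and the passage from subsoluble to Ramsey *)

Lemma subsoluble_ramsey (R : realType) (d : nat) (X : {fset 'rV[R]_d}) :
  kriz_theorem R -> subsoluble X -> ramsey X.
Proof.
move=> kriz [n [Y [solY [Z [f isof ->] /fsubsetP sZY]]]] k k_gt0.
have [N colN] := kriz n Y solY k k_gt0; exists N => colour.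
have [_ [g isog ->] [c monoc]] := colN colour.
have fXY x : x \in X -> f x \in Y by move=> Xx; apply: sZY; apply: in_imfset.
exists [fset g (f x) | x in X].
  exists (g \o f) => //= x y Xx Xy.
  by rewrite isog ?fXY// isof.
exists c => _ /imfsetP[x /= Xx ->]; apply: monoc.
by apply: in_imfset; apply: fXY.
Qed.

(** The product law is asked only on [G], because [sact] is shown to satisfy it only on [saff],
    whose elements commute with [flip]. *)
Lemma soluble_orbit (R : realType) (n : nat) (gT : finGroupType)
    (G : {group gT}) (act : 'rV[R]_n -> gT -> 'rV[R]_n) (y0 : 'rV[R]_n) :
  solvable G ->
  (forall y, act y 1%g = y) ->
  (forall y, {in G &, forall g h, act y (g * h)%g = act (act y g) h}) ->
  {in G, forall g x y, edist (act x g) (act y g) = edist x y} ->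
  soluble [fset act y0 g | g in G].
Proof.
move=> solG act1 actM isoG; set Y := [fset _ | _ in _].
have YP g y : g \in G -> y \in Y -> act y g \in Y.
  move=> Gg /imfsetP[h /= Gh ->]; rewrite -actM //.
  by apply: in_imfset; apply: groupM.
(* [is_action] wants injectivity for every element of the ambient group, hence
   the junk value outside [G]. *)
pose to (y : Y) g := if g \in G then insubd y (act (val y) g) else y.
have toE g (y : Y) : g \in G -> val (to y g) = act (val y) g.
  by move=> Gg; rewrite /to Gg insubdK //; apply: YP => //; apply: valP.
have toP : is_action G to.
  split=> [g x y|y g h Gg Gh].
    case: (boolP (g \in G)) => Gg; last by rewrite /to (negPf Gg).
    move/(congr1 (fun z => act (val z) g^-1%g)).
    rewrite !toE // -!actM ?groupV // mulgV !act1; exact: val_inj.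
  by apply: val_inj; rewrite !toE ?groupM // actM.
exists gT, G, (Action toP); split=> //; last first; rewrite /=.
  by move=> g Gg x y; rewrite !toE // isoG.
have Yy0 : y0 \in Y by apply/imfsetP; exists 1%g => //=; rewrite act1.
apply/imsetP; exists [` Yy0]; rewrite ?inE //.
apply/setP => y; rewrite !inE; symmetry; apply/orbitP.
have /imfsetP[g /= Gg ygE] := valP y.
by exists g => //; apply: val_inj; rewrite /= toE.
Qed.

(** * The soluble group of signed affine permutations of a finite field *)

Section SignedAffine.

Variable F : finFieldType.
Implicit Types (g h : {perm F * bool}) (z w : F * bool).

Definition flip_fun z := (z.1, ~~ z.2).

Lemma flip_funK : involutive flip_fun.
Proof. by case=> x s; rewrite /flip_fun /= negbK. Qed.

Definition flip : {perm F * bool} := perm (can_inj flip_funK).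

Lemma centflipP g :
  reflect (forall z, g (z.1, ~~ z.2) = ((g z).1, ~~ (g z).2)) (g \in 'C[flip]%g).
Proof.
apply: (iffP cent1P) => [gC z|gC].
  by have /permP/(_ z) := gC; rewrite !permM !permE.
by apply/permP => z; rewrite !permM !permE /= /flip_fun -gC.
Qed.

(* A signed permutation of the coordinates is encoded as a permutation of
   [F * bool] commuting with [flip]; the boolean is the sign. *)
Definition saff_set : {set {perm F * bool}} :=
  [set g in 'C[flip]%g | [exists a : F,
    [forall z, [forall w, (g z).1 - (g w).1 == a * (z.1 - w.1)]]]].

Lemma saffP g :
  reflect (g \in 'C[flip]%g /\
           exists a : F, forall z w, (g z).1 - (g w).1 = a * (z.1 - w.1))
          (g \in saff_set).
Proof.
rewrite [g \in saff_set]in_set; apply: (iffP andP) => -[gC].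
  by move=> /existsP[a /forallP aP]; split=> //; exists a => z w;
    have /forallP/(_ w)/eqP := aP z.
move=> [a aP]; split=> //; apply/existsP; exists a.
by apply/forallP => z; apply/forallP => w; rewrite aP.
Qed.

Lemma saff_group_set : group_set saff_set.
Proof.
apply/group_setP; split.
  by apply/saffP; split=> //; exists 1 => z w; rewrite !perm1 mul1r.
move=> g h /saffP[gC [a aP]] /saffP[hC [b bP]]; apply/saffP.
split; first exact: groupM.
by exists (b * a) => z w; rewrite !permM bP aP mulrA.
Qed.

Canonical saff := group saff_group_set.

(** The kernel of the slope map on [saff]: the underlying permutations are translations. *)
Definition strans_set : {set {perm F * bool}} :=
  [set g in 'C[flip]%g |
    [forall z, [forall w, (g z).1 - (g w).1 == z.1 - w.1]]].

Lemma stransP g :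
  reflect (g \in 'C[flip]%g /\ forall z w, (g z).1 - (g w).1 = z.1 - w.1)
          (g \in strans_set).
Proof.
rewrite [g \in strans_set]in_set; apply: (iffP andP) => -[gC].
  by move=> /forallP aP; split=> // z w; have /forallP/(_ w)/eqP := aP z.
by move=> aP; split=> //; apply/forallP => z; apply/forallP => w; rewrite aP.
Qed.

Lemma strans_group_set : group_set strans_set.
Proof.
apply/group_setP; split; first by apply/stransP; split=> // z w; rewrite !perm1.
move=> g h /stransP[gC aP] /stransP[hC bP]; apply/stransP.
by split; [exact: groupM | move=> z w; rewrite !permM bP aP].
Qed.

Canonical strans := group strans_group_set.

(** The pure sign changes: the kernel of the passage to underlying permutations of [F]. *)
Definition ssign_set : {set {perm F * bool}} :=
  [set g in 'C[flip]%g | [forall z, (g z).1 == z.1]].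

Lemma ssignP g :
  reflect (g \in 'C[flip]%g /\ forall z, (g z).1 = z.1) (g \in ssign_set).
Proof.
rewrite [g \in ssign_set]in_set; apply: (iffP andP) => -[gC].
  by move=> /forallP aP; split=> // z; exact/eqP.
by move=> aP; split=> //; apply/forallP => z; rewrite aP.
Qed.

Lemma ssign_group_set : group_set ssign_set.
Proof.
apply/group_setP; split; first by apply/ssignP; split=> // z; rewrite perm1.
move=> g h /ssignP[gC aP] /ssignP[hC bP]; apply/ssignP.
by split; [exact: groupM | move=> z; rewrite permM bP aP].
Qed.

Canonical ssign := group ssign_group_set.

(** Every point has the form [g (h z)], so this evaluates commutators without computing inverses. *)
Lemma commg_permE (g h : {perm F * bool}) z : [~ g, h]%g (g (h z)) = h (g z).
Proof. by rewrite -!permM mulgA -commgC. Qed.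

(** Slopes multiply in the commutative field [F], so commutators have slope 1. *)
Lemma der_saff : ([~: saff, saff] \subset strans)%g.
Proof.
rewrite gen_subG; apply/subsetP => _ /imset2P[g h /saffP[gC [a aP]] /saffP[hC [b bP]] ->].
apply/stransP; split; first by rewrite groupR.
move=> z w; rewrite -[z](permKV (h * g)%g) -[w](permKV (h * g)%g) !(permM h g).
by rewrite !commg_permE bP !aP bP; ring.
Qed.

(** Translations commute, so only signs survive in a commutator. *)
Lemma der_strans : ([~: strans, strans] \subset ssign)%g.
Proof.
rewrite gen_subG; apply/subsetP => _ /imset2P[g h /stransP[gC aP] /stransP[hC bP] ->].
apply/ssignP; split; first by rewrite groupR.
move=> z; rewrite -[z](permKV (h * g)%g) (permM h g) commg_permE.
set w := _ z; have := aP (h w) w; have := bP (g w) w => /eqP + /eqP.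
by rewrite !subr_eq => /eqP-> /eqP->; ring.
Qed.

(** On each two-point fibre over [F], the only choices are the identity and the swap, which
    commute. *)
Lemma ssign_abelian : abelian ssign.
Proof.
apply/centsP => g /ssignP[/centflipP gC aP] h /ssignP[/centflipP hC bP].
apply/permP => z; rewrite !permM.
have E (k : {perm F * bool}) : (k z).1 = z.1 -> k z = z \/ k z = (z.1, ~~ z.2).
  case: (k z) => x s /= ->; case: z => y t /=.
  by case: s; case: t; [left|right|right|left].
by case: (E g (aP z)); case: (E h (bP z)) => hz gz;
  rewrite ?hz ?gz ?gC ?hC ?hz ?gz ?hz.
Qed.

Lemma saff_solvable : solvable saff.
Proof.
have s2 : ([~: [~: saff, saff], [~: saff, saff]] \subset ssign)%g.
  exact: subset_trans (commgSS der_saff der_saff) der_strans.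
apply/derivedP; exists 3%N; rewrite !dergSn derg0.
by apply/trivgP; rewrite -(commG1P ssign_abelian); exact: commgSS.
Qed.

(** An affine map is combined with signs chosen freely at each point. The inverse of [g] is
    described because [sact] reads coordinates through it. *)
Lemma saff_two_transitive (a b : F) (e : F -> bool) : a != b ->
  exists2 g, g \in saff &
    exists f : F -> F, [/\ injective f, f a = 0, f b = 1
                         & forall x, (g^-1)%g (x, false) = (f x, e x)].
Proof.
move=> ab; have ba : b - a != 0 by rewrite subr_eq0 eq_sym.
pose f x := (x - a) / (b - a).
have finj : injective f by move=> x y /(mulIf (invr_neq0 ba))/addIr.
pose k z := (f z.1, e z.1 (+) z.2).
have kinj : injective k.
  by move=> [x s] [y t] [/finj -> /addbI ->].
exists (perm kinj)^-1%g; last first.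
  exists f; split=> //; rewrite /f ?subrr ?mul0r ?mulfV // => x.
  by rewrite invgK permE /k /= addbF.
rewrite groupV; apply/saffP; split.
  by apply/centflipP => z; rewrite !permE /k /= addbN.
by exists (b - a)^-1 => z w; rewrite !permE /k /f /=; field.
Qed.

End SignedAffine.

(** * The isometric action on vectors *)

Section SignedAffineAction.

Variables (R : realType) (p : nat).
(** For this [N], ['F_p] unfolds to ['I_N], so field elements index coordinates directly. *)
Local Notation N := (Zp_trunc (pdiv p)).+2.
Implicit Types (x y : 'rV[R]_N) (g h : {perm 'F_p * bool}).

(** A vector becomes a function on signed coordinates, odd under [flip], on which signed
    permutations act by precomposition. *)
Definition odd_ext y (z : 'F_p * bool) : R := (-1) ^+ z.2 * y ord0 z.1.

Definition sact y g : 'rV[R]_N := \row_k odd_ext y ((g^-1)%g (k, false)).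

(** [sact] is defined at sign [false] only; commutation with [flip] gives the other sign. *)
Lemma odd_ext_sact y g z :
  g \in saff 'F_p -> odd_ext (sact y g) z = odd_ext y ((g^-1)%g z).
Proof.
rewrite -groupV => /saffP[/centflipP gC _]; rewrite {1}/odd_ext mxE.
case: z => x [] /=; last by rewrite mul1r.
by rewrite (gC (x, false)) /odd_ext /= signrN mulN1r mulNr.
Qed.

Lemma sact1 y : sact y 1%g = y.
Proof. by apply/rowP => k; rewrite mxE invg1 perm1 /odd_ext mul1r. Qed.

Lemma sactM y : {in saff 'F_p &, forall g h, sact y (g * h)%g = sact (sact y g) h}.
Proof.
move=> g h Gg Gh; apply/rowP => k.
by rewrite [LHS]mxE [RHS]mxE odd_ext_sact // invMg permM.
Qed.

(** Each coordinate is counted once per sign, hence the factor 2; the doubled sum can be reindexed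
    by any permutation. *)
Lemma edist_odd_ext x y :
  edist x y = Num.sqrt ((\sum_z (odd_ext x z - odd_ext y z) ^+ 2) / 2).
Proof.
rewrite /edist; congr Num.sqrt.
rewrite -(pair_bigA _ (fun k s => (odd_ext x (k, s) - odd_ext y (k, s)) ^+ 2)).
rewrite mulr_suml; apply: eq_bigr => k _.
by rewrite big_bool /odd_ext /=; field.
Qed.

Lemma sact_isometry :
  {in saff 'F_p, forall g x y, edist (sact x g) (sact y g) = edist x y}.
Proof.
move=> g Gg x y; rewrite !edist_odd_ext; congr (Num.sqrt (_ / _)).
rewrite [RHS](reindex_inj (@perm_inj _ g^-1%g)); apply: eq_bigr => z _.
by rewrite !odd_ext_sact.
Qed.

Definition sorbit (c d h : R) : {fset 'rV[R]_N} :=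
  [fset sact (\row_(k < N) if (k : 'F_p) == 0 then c
                           else if (k : 'F_p) == 1 then d else h) g
    | g in saff 'F_p].

Lemma sorbit_soluble (c d h : R) : soluble (sorbit c d h).
Proof.
by apply: soluble_orbit;
  [exact: saff_solvable | exact: sact1 | exact: sactM | exact: sact_isometry].
Qed.

Lemma mem_sorbit (c d h : R) y (a b : 'F_p) :
  a != b -> y ord0 a = c -> y ord0 b = d ->
  (forall k, k != a -> k != b -> y ord0 k = h \/ y ord0 k = - h) ->
  y \in sorbit c d h.
Proof.
move=> ab ya yb yh.
(* Signs change exactly at the ordinary positions where the entry is not already [h]. *)
pose e (k : 'F_p) := [&& k != a, k != b & y ord0 k != h].
have [g Gg [f [finj fa fb gE]]] := saff_two_transitive e ab.
apply/imfsetP; exists g => //; apply/rowP => k; rewrite mxE gE /odd_ext /= mxE.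
rewrite -fa -fb !(inj_eq finj) /e.
have [->|ka] := eqVneq k a; first by rewrite mul1r.
have [->|kb] /= := eqVneq k b; first by rewrite mul1r.
have [->|yk] /= := eqVneq (y ord0 k) h; first by rewrite mul1r.
by case: (yh k ka kb) => [/eqP|->]; [rewrite (negPf yk) | rewrite mulN1r].
Qed.

End SignedAffineAction.

(** * Translation and padding with constant coordinates *)

Section Padding.

Variables (R : realType) (n N : nat) (c m : R).
Hypothesis le_nN : (n <= N)%N.

Definition pad (x : 'rV[R]_n) : 'rV[R]_N :=
  \row_(k < N) (oapp (x ord0) c (insub (val k)) - m).

Lemma pad_isometry x y : edist (pad x) (pad y) = edist x y.
Proof.
rewrite /edist; congr Num.sqrt.
(* Extended by 0 beyond [n]: the padding entries of the two vectors cancel. *)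
pose D k := oapp (fun k' : 'I_n => (x ord0 k' - y ord0 k') ^+ 2) 0 (insub k).
transitivity (\sum_(k < N) D k).
  apply: eq_bigr => k _; rewrite !mxE /D.
  by case: insubP => [k' _ _|_] /=; ring.
transitivity (\sum_(k < n) D k); last first.
  by apply: eq_bigr => k _; rewrite /D valK.
rewrite (big_ord_widen N D le_nN) [RHS]big_mkcond; apply: eq_bigr => k _.
by rewrite /D; case: insubP => [k' -> _|/negPf ->].
Qed.

(** [sigma] is extended by the identity, and the default [c] of [nth] supplies the padding
    entries. *)
Lemma pad_perm (s : seq R) (sigma : 'S_n) : size s = n ->
  exists tau : 'S_N, forall k,
    pad (col_perm sigma (\row_(k < n) s`_k)) ord0 k = nth c s (tau k) - m.
Proof.
move=> sz_s.
pose t (k : 'I_N) := oapp (fun k' : 'I_n => widen_ord le_nN (sigma k')) k (insub (val k)).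
have tinj : injective t.
  move=> k l; rewrite /t.
  case: insubP => [k' _ kE|kn]; case: insubP => [l' _ lE|ln] //= /(congr1 val) /= E.
  - by move/val_inj/perm_inj: E kE lE => -> -> /val_inj.
  - by case/negP: ln; rewrite /= -E ltn_ord.
  - by case/negP: kn; rewrite /= E ltn_ord.
exists (perm tinj) => k; rewrite !mxE permE /t.
case: insubP => [k' _ kE|kn] /=; rewrite ?mxE.
  by congr (_ - _); apply: set_nth_default; rewrite sz_s.
by rewrite nth_default // sz_s leqNgt.
Qed.

End Padding.

Lemma coord_perms_subsoluble (R : realType) (alpha beta : R) (i j n : nat)
    (t : seq R) :
  n = (i + j + size t)%N -> (size t <= 2)%N ->
  subsoluble (coord_perms n (nseq i alpha ++ nseq j beta ++ t)).
Proof.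
move=> nE sz_t; set s := _ ++ _.
have sz_s : size s = n by rewrite !size_cat !size_nseq addnA nE.
(* The bound leaves room for two exceptional positions even when [t] is shorter. *)
have [p lt_p p_pr] := prime_above (i + j + 2).
pose N := (Zp_trunc (pdiv p)).+2.
have NE : N = p by rewrite /N pdiv_id // Zp_cast ?prime_gt1.
have le_nN : (n <= N)%N by rewrite NE; lia.
have ltu : (i + j < N)%N by rewrite NE; lia.
have ltv : (i + j + 1 < N)%N by rewrite NE; lia.
(* These positions follow the two blocks; they hold the entries of [t], or the padding [alpha] where
   [t] has ended. *)
pose u := Ordinal ltu; pose v := Ordinal ltv.
pose m := (alpha + beta) / 2; pose h := (alpha - beta) / 2.
exists N, (@sorbit R p (nth alpha s u - m) (nth alpha s v - m) h).
split; first exact: sorbit_soluble.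
set X := coord_perms _ _.
exists [fset @pad R n N alpha m x | x in X].
  by exists (@pad R n N alpha m) => // x y _ _; apply: pad_isometry.
apply/fsubsetP => _ /imfsetP[_ /= /imfsetP[sigma _ ->] ->].
have [tau tauE] := pad_perm alpha m le_nN sigma sz_s.
apply: (@mem_sorbit _ _ _ _ _ _ ((tau^-1)%g u) ((tau^-1)%g v)).
- by rewrite (inj_eq perm_inj) -val_eqE /=; lia.
- by rewrite tauE permKV.
- by rewrite tauE permKV.
move=> k ku kv; rewrite tauE.
have {ku}: tau k != u by apply: contraNneq ku => <-; rewrite permK.
have {kv}: tau k != v by apply: contraNneq kv => <-; rewrite permK.
rewrite -!val_eqE /=; set l := val (tau k) => lv lu.
have hE : alpha - m = h by rewrite /m /h; field.
have hN : beta - m = - h by rewrite /m /h; field.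
rewrite /s catA nth_cat size_cat !size_nseq; case: ltnP => [lij|lij]; last first.
  (* Past [u] and [v] the list has ended, so the entry is the padding [alpha], which is centred to
     [h]. *)
  by left; rewrite nth_default //; lia.
rewrite nth_cat size_nseq; case: ltnP => li; rewrite nth_nseq; first by rewrite li; left.
by rewrite ifT ?hN; [right | lia].
Qed.

Theorem theorem1p6 (R : realType) (alpha beta gamma delta : R) (i j : nat) :
  let X1 := coord_perms (i + j)
              (nseq i alpha ++ nseq j beta) in
  let X2 := coord_perms (i + j + 1)
              (nseq i alpha ++ nseq j beta ++ [:: gamma]) in
  let X3 := coord_perms (i + j + 2)
              (nseq i alpha ++ nseq j beta ++ [:: gamma; gamma]) in
  let X4 := coord_perms (i + j + 2)
              (nseq i alpha ++ nseq j beta ++ [:: gamma; delta]) in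
  [/\ subsoluble X1, subsoluble X2, subsoluble X3 & subsoluble X4] /\
  (kriz_theorem R -> [/\ ramsey X1, ramsey X2, ramsey X3 & ramsey X4]).
Proof.
move=> X1 X2 X3 X4.
have sub1 : subsoluble X1.
  rewrite /X1 -[nseq j beta]cats0.
  by apply: coord_perms_subsoluble; rewrite ?addn0.
have sub2 : subsoluble X2 by apply: coord_perms_subsoluble.
have sub3 : subsoluble X3 by apply: coord_perms_subsoluble.
have sub4 : subsoluble X4 by apply: coord_perms_subsoluble.
by split=> // kriz; split; apply: subsoluble_ramsey.
Qed.
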